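(* Let $n\ge 2$ and $[n]=\{1,2,\ldots,n\}$. Call an $n\times n$ matrix with entries in $\{0,1\}$ a $\Lambda_n^2$-matrix if every row and every column contains exactly two entries equal to $1$. Let $\mathcal D_n$ be the set of all data $\Delta$ of the following form: \begin{enumerate} \item a tuple $(x_2,\ldots,x_n)$ of nonnegative integers with $2x_2+3x_3+\cdots+nx_n=n$; \item an ordered pair $(\mathbf C,\mathbf A)$ of partitions of $[n]$, each having exactly $x_k$ blocks of cardinality $k$ for every $k=2,\ldots,n$ (and hence no blocks of size $1$). For each $k$ with $x_k\neq 0$, the size-$k$ blocks of $\mathbf C$ are listed as $C^{(k)}_1,\ldots,C^{(k)}_{x_k}$ and those of $\mathbf A$ as $A^{(k)}_1,\ldots,A^{(k)}_{x_k}$, each list in a fixed order determined by the partition (for instance, increasing order of the least elements of the blocks); \item for each $k$ with $x_k\neq 0$, a permutation $\rho_k\in S_{x_k}$; \item for each such $k$ and each $i=1,\ldots,x_k$: \begin{itemize} \item an ordering $c_2,c_3,\ldots,c_k$ of the set $C^{(k)}_i\setminus\{c_1\}$, where $c_1=\min C^{(k)}_i$; \item an ordering $a_1,a_2,\ldots,a_k$ of the set $A^{(k)}_{\rho_k(i)}$ satisfying $a_1<a_2$. \end{itemize} \end{enumerate} To such data $\Delta$ associate the set $R(\Delta)$ of triples consisting of \[ (c_1,a_1,a_2),\ (c_2,a_2,a_3),\ \ldots,\ (c_{k-1},a_{k-1},a_k),\ (c_k,a_k,a_1), \] taken over all $k$ with $x_k\neq 0$ and all $i=1,\ldots,x_k$,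 where the $c_j$ and $a_j$ are those chosen for the pair $(k,i)$. Let $\Phi(\Delta)$ be the $n\times n$ binary matrix whose column $c$ has its entries equal to $1$ exactly in rows $u$ and $v$, where $(c,u,v)$ is a triple in $R(\Delta)$. Then: \begin{itemize} \item for every $\Delta\in\mathcal D_n$, the matrix $\Phi(\Delta)$ is a well-defined $\Lambda_n^2$-matrix; \item distinct data $\Delta\neq\Delta'$ give distinct matrices $\Phi(\Delta)\neq\Phi(\Delta')$; \item every $\Lambda_n^2$-matrix equals $\Phi(\Delta)$ for some $\Delta\in\mathcal D_n$. \end{itemize} Thus $\Phi$ is a bijection from $\mathcal D_n$ onto the set of all $\Lambda_n^2$-matrices.
   Context: $S_m$ denotes the symmetric group on $\{1,\ldots,m\}$. A partition of a set $M$ is a family of pairwise disjoint subsets, called blocks, whose union is $M$. ''Well-defined'' in the claim means that every $c\in[n]$ occurs as the first coordinate of exactly one triple in $R(\Delta)$, and that triple has $u\neq v$. *)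

(* Defs.v *)
(* [n] = {1..n} is represented by 'I_n = {0..n-1}. *)
From mathcomp Require Import all_boot all_fingroup all_algebra.
Set Implicit Arguments. Unset Strict Implicit. Unset Printing Implicit Defensive.

Section Defs.
Variable n : nat.

Definition setmin (B : {set 'I_n}) : option 'I_n :=
  [pick c in B | [forall c' in B, c <= c']].

Definition minkey (B : {set 'I_n}) : nat := odflt 0 (omap val (setmin B)).

Definition blocks (P : {set {set 'I_n}}) (k : nat) : seq {set 'I_n} :=
  sort (fun B B' => minkey B <= minkey B') (filter (fun B : {set 'I_n} => #|B| == k) (enum P)).

(* A datum Delta: x k is x_k (k ranges over 0..n; entries 0,1 must vanish),
   Cp, Ap the partitions C and A, rho k the permutation rho_k in S_{x_k},
   cord k i the ordering (c_2,...,c_k) chosen for the pair (k,i),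
   aord k i the ordering (a_1,...,a_k) chosen for the pair (k,i). *)
Record data := Data {
  x : {ffun 'I_n.+1 -> nat};
  Cp : {set {set 'I_n}};
  Ap : {set {set 'I_n}};
  rho : {dffun forall k : 'I_n.+1, 'S_(x k)};
  cord : {dffun forall k : 'I_n.+1, (x k).-tuple (seq 'I_n)};
  aord : {dffun forall k : 'I_n.+1, (x k).-tuple (seq 'I_n)}
}.

Definition Cblock (D : data) (k : 'I_n.+1) (i : 'I_(x D k)) : {set 'I_n} :=
  nth set0 (blocks (Cp D) k) i.

Definition Ablock (D : data) (k : 'I_n.+1) (i : 'I_(x D k)) : {set 'I_n} :=
  nth set0 (blocks (Ap D) k) (rho D k i).

Definition in_D (D : data) : Prop :=
  [/\ (forall k : 'I_n.+1, k < 2 -> x D k = 0) /\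
        \sum_(k < n.+1) k * x D k = n,
      partition (Cp D) [set: 'I_n] /\ partition (Ap D) [set: 'I_n],
      (forall k : 'I_n.+1, #|[set B in Cp D | #|B| == k]| = x D k
                         /\ #|[set B in Ap D | #|B| == k]| = x D k),
      (forall (k : 'I_n.+1) (i : 'I_(x D k)),
         match setmin (Cblock i) with
         | Some c1 => perm_eq (tnth (cord D k) i) (enum (Cblock i :\ c1))
         | None => false
         end) &
      (forall (k : 'I_n.+1) (i : 'I_(x D k)),
         perm_eq (tnth (aord D k) i) (enum (Ablock i)) /\
         match tnth (aord D k) i with
         | a1 :: a2 :: _ => a1 < a2
         | _ => false
         end)].

Definition cyc_triples (cs as_ : seq 'I_n) : seq ('I_n * ('I_n * 'I_n)) :=
  zip cs (zip as_ (rot 1 as_)).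

Definition triples (D : data) (k : 'I_n.+1) (i : 'I_(x D k))
  : seq ('I_n * ('I_n * 'I_n)) :=
  match setmin (Cblock i) with
  | Some c1 => cyc_triples (c1 :: tnth (cord D k) i) (tnth (aord D k) i)
  | None => [::]
  end.

Definition Rset (D : data) : {set ('I_n * ('I_n * 'I_n))} :=
  \bigcup_(k : 'I_n.+1) \bigcup_(i : 'I_(x D k)) [set t | t \in triples i].

Definition well_defined (D : data) : Prop :=
  forall c : 'I_n, exists t : 'I_n * ('I_n * 'I_n),
    [set t' in Rset D | t'.1 == c] = [set t] /\ t.2.1 != t.2.2.

Definition Phi (D : data) : 'M[nat]_n :=
  \matrix_(r < n, c < n)
    (if [exists t in Rset D, (t.1 == c) && ((t.2.1 == r) || (t.2.2 == r))]
     then 1 else 0).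

Definition is_Lambda2 (M : 'M[nat]_n) : Prop :=
  [/\ forall i j, M i j = 0 \/ M i j = 1,
      forall i, #|[set j | M i j == 1]| = 2 &
      forall j, #|[set i | M i j == 1]| = 2].

End Defs.

(* Main.v *)
(* A datum amounts to two permutations of the index set: g, sending a column to
   the next one in its cycle, and U, sending a column c to the first row of its
   triple, so that R = {(c, U c, U (g c))}.  The blocks of C are the cycles of
   g, those of A are their images under U, and the normalisations c_1 = min and
   a_1 < a_2 say that g has no fixed point and that U c < U (g c) whenever c is
   the least column of its cycle.
   The matrix gives back (g, U) up to the direction of each cycle, which the
   inequality at the least column fixes.  Conversely, on the pairs (column, row)
   carrying a 1, let t exchange the two rows of a column and s the two columns
   of a row.  The cycles of s o t come in pairs exchanged by t, and choosing one
   of each pair according to the inequality defines (g, U). *)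
Require Import Defs.
From mathcomp Require Import all_boot all_fingroup all_algebra.
From mathcomp Require Import zify.
Set Implicit Arguments. Unset Strict Implicit. Unset Printing Implicit Defensive.

(** * The exchange of the two elements of a pair *)

Section Other.
Variable T : finType.
Implicit Types (A : {set T}) (u : T).

(** Being the identity off [A] makes this an involution of the whole type, so no membership
    hypothesis is needed in [otherK]. *)
Definition other A u : T :=
  if u \in A then odflt u [pick v in A :\ u] else u.

Lemma otherP A u : #|A| = 2 -> u \in A ->
  [/\ other A u \in A, other A u != u & A = [set u; other A u]].
Proof.
move=> cA uA; rewrite /other uA; case: pickP => [v | no] /=.
  rewrite !inE => /andP[vu vA]; split=> //.
  apply/esym/eqP; rewrite eqEcard subUset !sub1set uA vA cA cards2 eq_sym vu //.
by move: (cardsD1 u A); rewrite uA cA (eq_card0 no).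
Qed.

Lemma otherK A : #|A| = 2 -> involutive (other A).
Proof.
move=> cA u; have [uA|uA] := boolP (u \in A); last by rewrite /other !(negPf uA).
have [vA vu E] := otherP cA uA; have [wA wv _] := otherP cA vA.
by move: wA; rewrite E !inE -E (negPf wv) orbF => /eqP.
Qed.

End Other.

(** * Cycles of the composite of two involutions *)

Section Dihedral.
Variables (T : finType) (s t : T -> T).
Hypotheses (sK : involutive s) (tK : involutive t).
Let f y := s (t y).

Lemma dihedral_inj : injective f.
Proof. by apply: inj_comp; apply: inv_inj. Qed.

Lemma dihedral_conj y : f (t (f y)) = t y.
Proof. by rewrite /f tK sK. Qed.

(** Since [f t f = t], a step of [f] from a point becomes under [t] a step backwards; [f] being
    injective, connectedness is symmetric. *)
Lemma dihedral_fconnect y z : fconnect f y z -> fconnect f (t y) (t z).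
Proof.
move/iter_findex => <-; elim: (findex _ _ _) => [|i IH] /=; first exact: connect0.
apply: connect_trans IH _; rewrite (fconnect_sym dihedral_inj).
by rewrite -(dihedral_conj (iter i f y)) fconnect1.
Qed.

(* If f^(m+2) y = t y, then f t f = t gives f^m (f y) = t (f y); descending on m
   yields a fixed point of t or of s. *)
Lemma dihedral_split (P : pred T) y :
  (forall z, P z -> P (s z)) -> (forall z, P z -> P (t z)) ->
  (forall z, P z -> s z != z) -> (forall z, P z -> t z != z) ->
  P y -> ~~ fconnect f y (t y).
Proof.
move=> Ps Pt ns nt Py; apply/negP => /iter_findex; move: (findex _ _ _) => m.
elim/ltn_ind: m y Py => -[|[|m]] IH y Py /= E.
- by have := nt _ Py; rewrite -E eqxx.
- by have := ns _ (Pt _ Py); rewrite -[s _]/(f y) E eqxx.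
apply: (IH m _ (f y)) => //; first exact/Ps/Pt.
by apply: dihedral_inj; rewrite dihedral_conj -E -iterS -iterSr.
Qed.

End Dihedral.

(** * Orbits of a permutation *)

Lemma porbit_sub (T : finType) (g g' : {perm T}) c :
  (forall c', g c' \in porbit g' c') -> porbit g c \subset porbit g' c.
Proof.
move=> H; apply/subsetP=> _ /porbitP[i ->]; rewrite permX.
elim: i => [|i IH] /=; first exact: porbit_id.
by have := H (iter i g c); rewrite -!eq_porbit_mem => /eqP->; rewrite eq_porbit_mem.
Qed.

Lemma porbit_eq (T : finType) (g : {perm T}) c c' :
  c' \in porbit g c -> porbit g c' = porbit g c.
Proof. by rewrite -eq_porbit_mem => /eqP. Qed.

Lemma mem_porbit_next (T : finType) (g : {perm T}) c : g c \in porbit g c.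
Proof. exact: (mem_porbit g 1). Qed.

Lemma card_porbit_gt1 (T : finType) (g : {perm T}) c :
  (1 < #|porbit g c|) = (g c != c).
Proof.
apply/idP/idP => [|ng].
  apply: contraTneq => gc; rewrite -leqNgt -(cards1 c); apply/subset_leq_card.
  apply/subsetP=> _ /porbitP[i ->]; rewrite inE permX.
  by elim: i => //= i /eqP->; rewrite gc.
suff <-: #|[set c; g c]| = 2.
  apply/subset_leq_card/subsetP => z; rewrite !inE.
  by case/orP=> /eqP->; rewrite ?porbit_id ?mem_porbit_next.
by rewrite cards2 eq_sym ng.
Qed.

Lemma porbits_partition (T : finType) (g : {perm T}) : partition (porbits g) [set: T].
Proof.
apply/and3P; split.
- rewrite eqEsubset subsetT; apply/subsetP=> c _; apply/bigcupP.
  by exists (porbit g c); rewrite ?porbit_id ?imset_f.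
- apply/trivIsetP => _ _ /imsetP[c _ ->] /imsetP[d _ ->]; apply: contraR.
  by case/pred0Pn => z /= /andP[zc zd]; rewrite -(porbit_eq zc) -(porbit_eq zd).
- by apply/imsetP => -[c _ E]; have := porbit_id g c; rewrite -E inE.
Qed.

Lemma map_perm_traject (T : finType) (g : {perm T}) c m :
  map g (traject g c m) = traject g (g c) m.
Proof. by elim: m c => //= m IH c; rewrite IH. Qed.

(** Used to turn the rotated list of rows in [cyc_triples] into the rows of the next columns, the
    closing triple [(c_k, a_k, a_1)] included. *)
Lemma rot1_traject_porbit (T : finType) (g : {perm T}) c :
  rot 1 (traject g c #|porbit g c|) = map g (traject g c #|porbit g c|).
Proof.
have := iter_porbit g c; have := card_porbit_neq0 g c.
case: #|_| => // m _ E.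
by rewrite trajectS rot1_cons -trajectS map_perm_traject trajectSr -iterSr E.
Qed.

(** * Oriented pairs of permutations and their matrices *)

Section Pairs.
Variable n : nat.
Implicit Types (g U : {perm 'I_n}) (M : 'M[nat]_n).

Definition oriented g U : Prop :=
  (forall c, g c != c) /\
  (forall c, (forall c', c' \in porbit g c -> c <= c') -> U c < U (g c)).

Definition pair_mx g U : 'M[nat]_n :=
  \matrix_(r < n, c < n) (if (U c == r) || (U (g c) == r) then 1 else 0).

Lemma pair_mxE g U r c :
  (pair_mx g U r c == 1) = (U c == r) || (U (g c) == r).
Proof. by rewrite mxE; case: ifP. Qed.

Lemma pair_mx_Lambda2 g U : (forall c, g c != c) -> is_Lambda2 (pair_mx g U).
Proof.
move=> ng; split=> [i j|r|c].
- by rewrite mxE; case: ifP; [right|left].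
- suff ->: [set j | pair_mx g U r j == 1] = [set (U^-1)%g r; (g^-1)%g ((U^-1)%g r)].
    by rewrite cards2 -(inj_eq (@perm_inj _ g)) permKV ng.
  apply/setP=> c; rewrite !inE pair_mxE.
  by rewrite !(canF_eq (permK U)) (canF_eq (permK g)).
- suff ->: [set i | pair_mx g U i c == 1] = [set U c; U (g c)].
    by rewrite cards2 (inj_eq perm_inj) eq_sym ng.
  by apply/setP=> r; rewrite !inE pair_mxE !(eq_sym r).
Qed.

Lemma porbit_min g c : exists2 m, m \in porbit g c &
  forall c', c' \in porbit g m -> m <= c'.
Proof.
case: (arg_minnP (fun y : 'I_n => y : nat) (porbit_id g c)) => m mc H; exists m => //.
by move=> c'; rewrite (porbit_eq mc); apply: H.
Qed.

Section Uniqueness.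
Variables g U g' U' : {perm 'I_n}.
Hypotheses (o : oriented g U) (o' : oriented g' U').
Hypothesis E : forall r c,
  (U c == r) || (U (g c) == r) = (U' c == r) || (U' (g' c) == r).

(** The distinct columns [c] and [g c] share the row [U (g c)]. For [(g', U')], distinct columns
    sharing a row are consecutive under [g'], so [g c = g' c] or [c = g' (g c)]. *)
Lemma next_in_porbit c : g c \in porbit g' c.
Proof.
have ng := o.1 c.
have /esym := E (U (g c)) c; rewrite eqxx orbT => /orP[]/eqP E1;
have /esym := E (U (g c)) (g c); rewrite eqxx /= -E1 !(inj_eq perm_inj) => /orP[]/eqP E2.
- by rewrite E2 eqxx in ng.
- by have := mem_porbit_next g' (g c); rewrite E2 porbit_sym.
- by rewrite E2; apply: mem_porbit_next.
- by rewrite E2 eqxx in ng.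
Qed.

(** Agreement on one row of column [c] forces agreement on the other, [U (g c) = U' (g' c)]; the
    second column meeting that row is then the same too. Hence agreement propagates along a
    cycle. *)
Lemma agree_next c : U c = U' c -> g c = g' c /\ U (g c) = U' (g c).
Proof.
move=> Ec; have ng := o.1 c.
have /esym := E (U (g c)) c.
rewrite eqxx orbT -Ec (inj_eq perm_inj) eq_sym (negPf ng) /= => /eqP E1.
have /esym := E (U (g c)) (g c); rewrite eqxx /= => /orP[]/eqP E2; last first.
  by rewrite -E1 in E2; move: E2 ng => /perm_inj/perm_inj->; rewrite eqxx.
by rewrite E2; split=> //; move: E2; rewrite -E1 => /perm_inj.
Qed.
End Uniqueness.

Lemma pair_mx_inj g U g' U' : oriented g U -> oriented g' U' ->
  pair_mx g U = pair_mx g' U' -> g = g' /\ U = U'.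
Proof.
move=> o o' EM.
have E r c : (U c == r) || (U (g c) == r) = (U' c == r) || (U' (g' c) == r).
  by rewrite -!pair_mxE EM.
have agree c : U c = U' c.
  have [m mc m_min] := porbit_min g c.
  have Em : U m = U' m.
    have mg := o.2 _ m_min.
    (* [m] is also least on its [g']-cycle, as that cycle lies inside the [g]-cycle. *)
    have mg' : U' m < U' (g' m).
      apply: o'.2 => c' c'm; apply: m_min; move: c'm; apply/subsetP/porbit_sub => c''.
      by apply: (@next_in_porbit g' U' g U) => // r d; rewrite E.
    (* Otherwise the two rows of column [m] would be swapped between the two pairs, against the
       inequalities [mg] and [mg']. *)
    have /esym := E (U m) m; rewrite eqxx /= => /orP[]/eqP // E1.
    have := E (U' m) m; rewrite eqxx /= => /orP[]/eqP // E2.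
    by move: mg mg'; rewrite E1 E2; lia.
  rewrite porbit_sym in mc; case/porbitP: mc => i ->; rewrite permX.
  by elim: i => //= i IH; case: (agree_next o E IH).
split; apply/permP => c //; by case: (agree_next o E (agree c)).
Qed.

End Pairs.

(** * From a matrix to an oriented pair *)

Section Orientation.
Variables (n : nat) (M : 'M[nat]_n).
Hypothesis LM : is_Lambda2 M.

Let Col c := [set r | M r c == 1].
Let Row r := [set c | M r c == 1].
Let dart := [pred d : 'I_n * 'I_n | M d.2 d.1 == 1].
Let t (d : 'I_n * 'I_n) := (d.1, other (Col d.1) d.2).
Let s (d : 'I_n * 'I_n) := (other (Row d.2) d.1, d.2).
Let f d := s (t d).

Let cCol c : #|Col c| = 2. Proof. case: LM => _ _; exact. Qed.
Let cRow r : #|Row r| = 2. Proof. case: LM => _ + _; exact. Qed.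

Let tK : involutive t.
Proof. by case=> c u; rewrite /t /= otherK ?cCol. Qed.
Let sK : involutive s.
Proof. by case=> c u; rewrite /s /= otherK ?cRow. Qed.

Let dart_t d : dart d -> dart (t d).
Proof.
case: d => c u /= H; have uC : u \in Col c by rewrite inE.
by have [] := otherP (cCol c) uC; rewrite inE.
Qed.
Let dart_s d : dart d -> dart (s d).
Proof.
case: d => c u /= H; have uC : c \in Row u by rewrite inE.
by have [] := otherP (cRow u) uC; rewrite inE.
Qed.
Let t_neq d : dart d -> (t d).2 != d.2.
Proof.
case: d => c u /= H; have uC : u \in Col c by rewrite inE.
by have [] := otherP (cCol c) uC.
Qed.
Let s_neq d : dart d -> (s d).1 != d.1.
Proof.
case: d => c u /= H; have uC : c \in Row u by rewrite inE.
by have [] := otherP (cRow u) uC.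
Qed.
Let f_inj : injective f. Proof. exact: dihedral_inj. Qed.
Let fsym := fconnect_sym f_inj.

Let split_t d : dart d -> ~~ fconnect f d (t d).
Proof.
apply: dihedral_split => // z Pz.
  by apply: contra (s_neq Pz) => /eqP->.
by apply: contra (t_neq Pz) => /eqP->.
Qed.

Let dart_fconnect d e : fconnect f d e -> dart d -> dart e.
Proof.
move/iter_findex => <- dd.
by elim: (findex _ _ _) => // i IH; exact: (dart_s (dart_t IH)).
Qed.

(* One of the two orientations of each cycle: its least column is entered
   through the smaller of its two rows. *)
Let leading e :=
  [forall e', fconnect f e e' ==> (e.1 <= e'.1)] && (e.2 < (t e).2).
Let positive d := [exists e, fconnect f d e && leading e].

Let positive_fconnect d e : fconnect f d e -> positive d = positive e.
Proof.
by move=> de; apply/eq_existsb => z; rewrite (same_connect fsym de).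
Qed.

(** The cycles of [d] and [t d] are distinct and visit the same columns. Of the two darts in the
    least column exactly one has the smaller row, so exactly one of the two cycles has a leading
    dart. *)
Let positive_t d : dart d -> positive (t d) = ~~ positive d.
Proof.
move=> dd; apply/idP/idP => [/existsP[e /andP[te /andP[/forallP me le]]]|].
  apply/existsP=> -[e' /andP[de' /andP[/forallP me' le']]].
  (* Suppose both cycles have leading darts, [e] and [e']. As [t] exchanges the cycles and keeps
     columns, each of [e.1], [e'.1] bounds the other; both darts then take the smaller row, so
     [e = e'], against [split_t]. *)
  have ete' : fconnect f e (t e').
    by apply: connect_trans (dihedral_fconnect sK tK de'); rewrite fsym.
  have e'te : fconnect f e' (t e).
    have := dihedral_fconnect sK tK te; rewrite tK; apply: connect_trans.
    by rewrite fsym.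
  have Ec : e.1 = e'.1.
    apply/val_inj/eqP; rewrite eqn_leq.
    by have /implyP/(_ ete') := me (t e') => ->; have /implyP/(_ e'te) := me' (t e) => ->.
  have de := dart_fconnect te (dart_t dd); have dd' := dart_fconnect de' dd.
  have Er : e.2 = e'.2.
    move: le le' de dd' Ec; case: (e) (e') => c u [c' u'] /= le le' de dd' Ec; subst c'.
    have uC : u \in Col c by rewrite inE.
    have [_ _ EC] := otherP (cCol c) uC.
    have : u' \in Col c by rewrite inE.
    rewrite EC !inE => /orP[]/eqP // Eu.
    by move: le le'; rewrite Eu otherK ?cCol //; lia.
  have Ee : e = e' by case: (e) (e') Ec Er => ? ? [? ?] /= -> ->.
  move: (split_t dd); rewrite (connect_trans de') // -Ee fsym //.
(* Conversely, take a dart [e] in the least column of the cycle of [d]: either [e] or [t e] is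
   leading. *)
have [e de emin] := arg_minnP (fun e : 'I_n * 'I_n => val e.1) (connect0 (frel f) d).
have de' := dart_fconnect de dd.
have min_e e' : fconnect f e e' -> e.1 <= e'.1.
  by move=> ee'; apply: emin; apply: connect_trans ee'.
apply: contraR => /existsP H.
have te := dihedral_fconnect sK tK de.
apply/existsP; exists e; rewrite de /=; apply/andP; split.
  by apply/forallP=> e'; apply/implyP/min_e.
rewrite ltnNge; apply/negP => le; apply: H; exists (t e); rewrite te /=.
apply/andP; split.
  apply/forallP => e'; apply/implyP => /(dihedral_fconnect sK tK).
  by rewrite tK => /min_e.
by rewrite tK ltn_neqAle le andbT; exact: t_neq.
Qed.

Let exists_positive c : exists u, (dart (c, u)) && positive (c, u).
Proof.
have /card_gt0P[u uC] : 0 < #|Col c| by rewrite cCol.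
have du : dart (c, u) by rewrite inE in uC.
have [p|p] := boolP (positive (c, u)); first by exists u; rewrite p andbT.
by exists (other (Col c) u); rewrite -positive_t // in p; rewrite p andbT; apply: (dart_t du).
Qed.

(** Each column has exactly one positive dart: [U] takes its row, and [g] the column of its image
    under [f], which is again positive. *)
Lemma Lambda2_orientation : exists g U : {perm 'I_n}, oriented g U /\ pair_mx g U = M.
Proof.
have [U0 HU] := fin_all_exists exists_positive.
pose g0 c := (f (c, U0 c)).1.
have dU c : dart (c, U0 c) by case/andP: (HU c).
have pU c : positive (c, U0 c) by case/andP: (HU c).
have posE d : dart d -> positive d -> U0 d.1 = d.2.
  case: d => c u du pu /=; have uC : u \in Col c by rewrite inE.
  have [_ _ EC] := otherP (cCol c) uC.
  have : U0 c \in Col c by rewrite inE; exact: dU.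
  rewrite EC !inE => /orP[]/eqP // Eu.
  by have := pU c; rewrite Eu -[(c, _)]/(t (c, u)) positive_t // pu.
have fE c : f (c, U0 c) = (g0 c, U0 (g0 c)).
  rewrite [LHS]surjective_pairing -/(g0 c); congr (_, _); apply/esym/posE.
    exact: (dart_s (dart_t (dU c))).
  by rewrite -(positive_fconnect (fconnect1 f _)).
have UgE c : U0 (g0 c) = other (Col c) (U0 c) by have [] := fE c.
(* Positive darts of two columns in one row would be exchanged by [s]. But [s d = f (t d)], where
   [t] reverses positivity and [f] preserves it. *)
have U_inj : injective U0.
  move=> c c' E; apply/eqP; rewrite -[_ == _]negbK; apply/negP => ncc.
  have cR : c \in Row (U0 c) by rewrite inE; exact: dU.
  have [_ _ ER] := otherP (cRow _) cR.
  have : c' \in Row (U0 c) by rewrite inE E; exact: dU.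
  rewrite ER !inE eq_sym (negPf ncc) /= => /eqP Ec'.
  have := pU c'; rewrite -E Ec' -[(_, U0 c)]/(s (c, U0 c)) -{1}[(c, U0 c)]tK.
  rewrite -[s _]/(f (t (c, U0 c))) -(positive_fconnect (fconnect1 f _)).
  by rewrite positive_t ?dU // pU.
have g_inj : injective g0.
  move=> c c' E; have : f (c, U0 c) = f (c', U0 c') by rewrite !fE E.
  by move/f_inj => [].
exists (perm g_inj), (perm U_inj); split; last first.
  apply/matrixP => r c; rewrite mxE !permE UgE.
  have uC : U0 c \in Col c by rewrite inE; exact: dU.
  have [_ _ EC] := otherP (cCol c) uC.
  have : (r \in Col c) = (U0 c == r) || (other (Col c) (U0 c) == r).
    by rewrite EC !inE -EC !(eq_sym r).
  rewrite inE => <-; case: LM => H01 _ _.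
  by case: (H01 r c) => ->.
have fiter i c : iter i f (c, U0 c) = (iter i g0 c, U0 (iter i g0 c)).
  by elim: i => //= i ->; rewrite fE.
split=> c; first by rewrite permE /g0; exact: (s_neq (dart_t (dU c))).
move=> cmin; rewrite !permE UgE.
(* The leading dart [e] of the cycle of [(c, U0 c)] is that dart itself: [c] and [e.1] are both
   least among the columns visited. *)
have /existsP[e /andP[ce /andP[/forallP me le]]] := pU c.
have ec := ce; rewrite fsym in ec.
have ce1 : c <= e.1.
  rewrite -(iter_findex ce); move: (findex _ _ _) => i; rewrite fiter /=.
  apply: cmin; apply/porbitP; exists i; rewrite permX.
  by apply: eq_iter => z; rewrite permE.
have /implyP/(_ ec) /= e1c := me (c, U0 c).
have de := dart_fconnect ce (dU c).
have pe : positive e by rewrite -(positive_fconnect ce).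
have Ee := posE _ de pe.
have Ec : e.1 = c by apply/val_inj/eqP; rewrite eqn_leq ce1 e1c.
by move: le; rewrite /t /= -Ee Ec.
Qed.

End Orientation.

(** * Least elements and listings of blocks *)

Section Blocks.
Variable n : nat.
Implicit Types (B : {set 'I_n}) (P : {set {set 'I_n}}).

Lemma setmin_min B c :
  setmin B = Some c -> c \in B /\ forall c', c' \in B -> c <= c'.
Proof.
by rewrite /setmin; case: pickP => // d /andP[dB /forall_inP d_min] [<-].
Qed.

Lemma setmin_exists B : B != set0 -> exists c, setmin B = Some c.
Proof.
case/set0Pn=> c cB; rewrite /setmin; case: pickP => [d _ | no]; first by exists d.
case: (arg_minnP (fun y : 'I_n => y : nat) cB) => d dB d_min.
by have := no d; rewrite (_ : d \in B) //= => /forall_inP[].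
Qed.

Lemma mem_blocks P k B : (B \in blocks P k) = (B \in P) && (#|B| == k).
Proof. by rewrite mem_sort mem_filter mem_enum andbC. Qed.

Lemma blocks_uniq P k : uniq (blocks P k).
Proof. by rewrite sort_uniq filter_uniq ?enum_uniq. Qed.

Lemma size_blocks P k : size (blocks P k) = #|[set B in P | #|B| == k]|.
Proof.
by rewrite -(card_uniqP (blocks_uniq P k)); apply: eq_card => B; rewrite inE mem_blocks.
Qed.

Section Listing.
Variables (P : {set {set 'I_n}}) (m : 'I_n.+1 -> nat).
Hypothesis cardP : forall k : 'I_n.+1, #|[set B in P | #|B| == k]| = m k.
Implicit Type k : 'I_n.+1.

Lemma nth_blocksP k (i : 'I_(m k)) :
  nth set0 (blocks P k) i \in P /\ #|nth set0 (blocks P k) i| = k.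
Proof.
have : nth set0 (blocks P k) i \in blocks P k.
  by rewrite mem_nth // size_blocks cardP.
by rewrite mem_blocks => /andP[? /eqP].
Qed.

Lemma nth_blocks_surj B : B \in P ->
  exists k (i : 'I_(m k)), nth set0 (blocks P k) i = B.
Proof.
move=> BP; have kB : #|B| < n.+1 by rewrite ltnS -[X in _ <= X]card_ord max_card.
have BB : B \in blocks P (Ordinal kB) by rewrite mem_blocks BP /=.
have iB : index B (blocks P (Ordinal kB)) < m (Ordinal kB).
  by rewrite -cardP -size_blocks index_mem.
by exists (Ordinal kB), (Ordinal iB); rewrite /= nth_index.
Qed.

(** The indices have types depending on [k] and [k'], hence the tagged equality. The cardinality of
    the block gives [k], and the absence of repetitions gives [i]. *)
Lemma nth_blocks_inj k k' (i : 'I_(m k)) (i' : 'I_(m k')) :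
  nth set0 (blocks P k) i = nth set0 (blocks P k') i' ->
  Tagged (fun k => 'I_(m k)) i = Tagged (fun k => 'I_(m k)) i'.
Proof.
move=> E; have Ek : k = k'.
  by apply/val_inj; rewrite /= -(nth_blocksP i).2 E (nth_blocksP i').2.
subst k'; congr Tagged; apply/val_inj/eqP.
by rewrite /= -(nth_uniq set0 _ _ (blocks_uniq P k)) ?E ?size_blocks ?cardP.
Qed.

End Listing.
End Blocks.

(** * The correspondence between data and oriented pairs *)

Section Encoding.
Variable n : nat.
Implicit Types (D : data n) (g U : {perm 'I_n}).

(* Along each cycle, g is the next column and U c the first of the two rows of column c. *)
Definition encodes D g U : Prop :=
  [/\ Cp D = porbits g,
      Ap D = [set U @: (B : {set 'I_n}) | B in porbits g],
      forall (k : 'I_n.+1) (i : 'I_(x D k)), Ablock i = U @: Cblock i &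
      forall (k : 'I_n.+1) (i : 'I_(x D k)), exists c,
        [/\ setmin (Cblock i) = Some c,
            c :: tnth (cord D k) i = traject g c k &
            tnth (aord D k) i = map U (traject g c k)]].

(** * From a datum to an oriented pair *)

Section Datum.
Variable D : data n.
Hypothesis inD : in_D D.
Implicit Type k : 'I_n.+1.

Local Notation ix i := (Tagged (fun k : 'I_n.+1 => 'I_(x D k)) i).

Lemma CblockP k (i : 'I_(x D k)) : Cblock i \in Cp D /\ #|Cblock i| = k.
Proof. by case: inD => _ _ H _ _; apply: nth_blocksP => k'; case: (H k'). Qed.

Lemma AblockP k (i : 'I_(x D k)) : Ablock i \in Ap D /\ #|Ablock i| = k.
Proof. by case: inD => _ _ H _ _; apply: nth_blocksP => k'; case: (H k'). Qed.

Lemma Cblock_surj B : B \in Cp D -> exists k (i : 'I_(x D k)), Cblock i = B.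
Proof. by case: inD => _ _ H _ _; apply: nth_blocks_surj => k'; case: (H k'). Qed.

Lemma Ablock_surj B : B \in Ap D -> exists k (i : 'I_(x D k)), Ablock i = B.
Proof.
case: inD => _ _ H _ _ BA.
have [|k [j Ej]] := @nth_blocks_surj _ _ (x D) _ B BA; first by move=> k'; case: (H k').
by exists k, ((rho D k)^-1%g j); rewrite /Ablock permKV.
Qed.

Lemma Cblock_inj k k' (i : 'I_(x D k)) (i' : 'I_(x D k')) : Cblock i = Cblock i' ->
  ix i = ix i'.
Proof.
by case: inD => _ _ H _ _; apply: nth_blocks_inj => k''; case: (H k'').
Qed.

Lemma Ablock_inj k k' (i : 'I_(x D k)) (i' : 'I_(x D k')) : Ablock i = Ablock i' ->
  ix i = ix i'.
Proof.
move=> E; have Ek : k = k' by apply/val_inj; rewrite /= -(AblockP i).2 E (AblockP i').2.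
subst k'; case: inD => _ _ H _ _.
have /eqP := @nth_blocks_inj _ _ (x D) (fun k' => (H k').2) _ _ _ _ E.
by rewrite eq_Tagged => /eqP/perm_inj ->.
Qed.

Lemma setmin_Cblock k (i : 'I_(x D k)) : exists c, setmin (Cblock i) = Some c.
Proof.
have [_ [pC _] _ _ _] := inD.
exact/setmin_exists/(partition_neq0 pC)/(CblockP i).1.
Qed.

Definition columns (p : {k : 'I_n.+1 & 'I_(x D k)}) : seq 'I_n :=
  if setmin (Cblock (tagged p)) is Some c
  then c :: tnth (cord D (tag p)) (tagged p) else [::].

Definition rows (p : {k : 'I_n.+1 & 'I_(x D k)}) : seq 'I_n :=
  tnth (aord D (tag p)) (tagged p).

Lemma columns_perm p : perm_eq (columns p) (enum (Cblock (tagged p))).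
Proof.
case: p => k i; rewrite /columns /=.
case: inD => _ _ _ /(_ k i) H _; have [c Ec] := setmin_Cblock i.
move: H; rewrite Ec => H; have [cB _] := setmin_min Ec.
apply: (@perm_trans _ (c :: enum (Cblock i :\ c))); first by rewrite perm_cons.
apply: uniq_perm; rewrite ?enum_uniq //= ?mem_enum ?setD11 ?enum_uniq //.
by move=> d; rewrite inE !mem_enum !inE; case: eqP => // ->.
Qed.

Lemma rows_perm p : perm_eq (rows p) (enum (Ablock (tagged p))).
Proof. by case: inD => _ _ _ _ H; case: p => k i; case: (H k i). Qed.

Lemma columns_uniq p : uniq (columns p).
Proof. by rewrite (perm_uniq (columns_perm p)) enum_uniq. Qed.

Lemma rows_uniq p : uniq (rows p).
Proof. by rewrite (perm_uniq (rows_perm p)) enum_uniq. Qed.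

Lemma mem_columns p : columns p =i Cblock (tagged p).
Proof. by move=> c; rewrite (perm_mem (columns_perm p)) mem_enum. Qed.

Lemma mem_rows p : rows p =i Ablock (tagged p).
Proof. by move=> c; rewrite (perm_mem (rows_perm p)) mem_enum. Qed.

Lemma size_columns p : size (columns p) = tag p.
Proof. by rewrite (perm_size (columns_perm p)) -cardE (CblockP _).2. Qed.

Lemma size_rows p : size (rows p) = tag p.
Proof. by rewrite (perm_size (rows_perm p)) -cardE (AblockP _).2. Qed.

Lemma columns_cover c : exists p, c \in columns p.
Proof.
case: inD => _ [/cover_partition E _] _ _ _.
have : c \in cover (Cp D) by rewrite E inE.
case/bigcupP=> B /Cblock_surj[k [i <-]] cB.
by exists (ix i); rewrite mem_columns.
Qed.

Lemma columns_disjoint p q c : c \in columns p -> c \in columns q -> p = q.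
Proof.
rewrite !mem_columns; case: p q => k i [k' i'] /= ci ci'; apply: Cblock_inj.
case: inD => _ [/partition_trivIset tC _] _ _ _.
by rewrite -(def_pblock tC (CblockP i).1 ci) -(def_pblock tC (CblockP i').1 ci').
Qed.

Lemma rows_disjoint p q a : a \in rows p -> a \in rows q -> p = q.
Proof.
rewrite !mem_rows; case: p q => k i [k' i'] /= ci ci'; apply: Ablock_inj.
case: inD => _ [_ /partition_trivIset tC] _ _ _.
by rewrite -(def_pblock tC (AblockP i).1 ci) -(def_pblock tC (AblockP i').1 ci').
Qed.

(** Every column lies in exactly one list [columns p]. There [g] is the cyclic successor, and [U]
    reads [rows p] at the same position; disjointness and absence of repetitions make both
    injective. *)
Lemma encodes_exists : exists g U, oriented g U /\ encodes D g U.
Proof.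
have [pc Hpc] := fin_all_exists columns_cover.
have pcE p c : c \in columns p -> pc c = p by apply: columns_disjoint.
pose g0 c := next (columns (pc c)) c.
(* The default [c] is never returned, since both lists have length [tag (pc c)]. *)
pose U0 c := nth c (rows (pc c)) (index c (columns (pc c))).
have g0E p c : c \in columns p -> g0 c = next (columns p) c.
  by move=> /pcE cp; rewrite /g0 cp.
have mem_g0 p c : c \in columns p -> g0 c \in columns p.
  by move=> cp; rewrite (g0E p) // mem_next.
have pc_g0 c : pc (g0 c) = pc c by apply/pcE/mem_g0.
have g_inj : injective g0.
  move=> c c' E; have Ep : pc c = pc c' by rewrite -pc_g0 E pc_g0.
  move: E; rewrite /g0 Ep => E.
  by rewrite -(prev_next (columns_uniq (pc c')) c) E prev_next ?columns_uniq.
have index_lt c : index c (columns (pc c)) < size (rows (pc c)).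
  by rewrite size_rows -size_columns index_mem.
have mem_U0 c : U0 c \in rows (pc c) by apply: mem_nth.
have U_inj : injective U0.
  move=> c c' E; have Ep : pc c = pc c'.
    by apply: (@rows_disjoint _ _ (U0 c)); rewrite // E.
  have := index_lt c; have := index_lt c'; move: E (Hpc c) (Hpc c').
  rewrite /U0 Ep => E cp cp' l l'; move/eqP: E.
  rewrite (set_nth_default c') // nth_uniq ?rows_uniq // => /eqP.
  exact: index_inj.
pose g := perm g_inj; pose U := perm U_inj.
have key k (i : 'I_(x D k)) : exists c,
    [/\ setmin (Cblock i) = Some c, c :: tnth (cord D k) i = traject g c k,
        tnth (aord D k) i = map U (traject g c k) & Cblock i = porbit g c].
  pose p := ix i.
  have [c Ec] := setmin_Cblock i; exists c.
  have Ecols : columns p = c :: tnth (cord D k) i by rewrite /columns /= Ec.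
  have Etr : columns p = traject g c k.
    have : fcycle g (columns p).
      apply: cycle_from_next (columns_uniq p) _ => d dp.
      by rewrite /= permE (g0E p).
    rewrite -[X in traject _ _ X](size_columns p) Ecols /= rcons_path => /andP[/fpathE E _].
    by rewrite {1}E.
  have Erow : rows p = map U (columns p).
    apply: (@eq_from_nth _ c) => [|j]; first by rewrite size_map size_rows size_columns.
    rewrite size_rows -size_columns => lj; rewrite (nth_map c) // permE.
    have dp := mem_nth c lj; rewrite /U0 (pcE _ _ dp) index_uniq ?columns_uniq //.
    by apply: set_nth_default; rewrite size_rows -size_columns.
  split=> //; first by rewrite -Ecols.
    by rewrite -Etr -Erow.
  apply/setP=> d; rewrite -(mem_columns p); apply/idP/porbitP.
    by rewrite Etr => /trajectP[j _ ->]; exists j; rewrite permX.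
  case=> j ->; rewrite permX; elim: j => [|j IH] /=; first by rewrite Ecols inE eqxx.
  by rewrite permE mem_g0.
exists g, U.
have EA k (i : 'I_(x D k)) : Ablock i = U @: Cblock i.
  have [c [_ _ Er Eo]] := key k i; apply/setP=> a.
  rewrite -(mem_rows (ix i)) /rows /= Er.
  have Ek : k = #|porbit g c| :> nat by rewrite -Eo (CblockP i).2.
  apply/mapP/imsetP => -[d dc ->]; exists d => //; move: dc.
    by rewrite Ek Eo porbit_traject.
  by rewrite Ek Eo porbit_traject.
(* Block sizes exceed 1 because the condition [a1 < a2] fails on lists with fewer than two
   entries. *)
have [c0P two] : (forall c, exists k (i : 'I_(x D k)), porbit g c = Cblock i)
  /\ (forall k (i : 'I_(x D k)), 1 < k).
  split=> [c|k i].
    have := Hpc c; rewrite mem_columns; case: (pc c) => k i /= ci; exists k, i.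
    by have [d [_ _ _ Eo]] := key k i; rewrite Eo in ci *; apply: porbit_eq.
  case: inD => _ _ _ _ /(_ k i)[_]; rewrite -(size_rows (ix i)) /rows /=.
  by case: (tnth _ _) => [|? []].
split; split=> //.
- move=> c; rewrite -card_porbit_gt1; have [k [i ->]] := c0P c.
  by rewrite (CblockP i).2 two.
- move=> c cmin; have [k [i Ei]] := c0P c; have [d [Ed _ Er Eo]] := key k i.
  have [dB dmin] := setmin_min Ed.
  have Edc : d = c.
    by apply/val_inj/eqP; rewrite eqn_leq dmin -?Ei ?porbit_id // cmin // Ei.
  (* The rows of this block begin with [U c] and [U (g c)], so [a1 < a2] is the required
     inequality. *)
  have := two _ i; case: inD => _ _ _ _ /(_ k i)[_]; rewrite Er Edc.
  by case: (nat_of_ord k) => [|[]].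
- apply/setP=> B; apply/idP/imsetP => [/Cblock_surj[k [i <-]]|[c _ ->]].
    by have [c [_ _ _ ->]] := key k i; exists c.
  by have [k [i ->]] := c0P c; exact: (CblockP i).1.
- apply/setP=> B; apply/idP/imsetP => [/Ablock_surj[k [i <-]]|[_ /imsetP[c _ ->] ->]].
    by rewrite EA; have [c [_ _ _ ->]] := key k i; exists (porbit g c); rewrite ?imset_f.
  by have [k [i ->]] := c0P c; rewrite -EA; exact: (AblockP i).1.
- by move=> k i; have [c []] := key k i; exists c.
Qed.

Variables g U : {perm 'I_n}.
Hypothesis enc : encodes D g U.

Lemma Rset_encodes : Rset D = [set (c, (U c, U (g c))) | c : 'I_n].
Proof.
case: enc => EC _ _ H.
have tri k (i : 'I_(x D k)) : triples i =i [seq (c, (U c, U (g c))) | c <- enum (Cblock i)].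
  have [c [Ec Ecs Eas]] := H k i; have [cB _] := setmin_min Ec.
  have Eo : Cblock i = porbit g c.
    have := (CblockP i).1; rewrite EC => /imsetP[d _ Ed].
    by rewrite Ed in cB *; rewrite (porbit_eq cB).
  have Ek : k = #|porbit g c| :> nat by rewrite -Eo (CblockP i).2.
  move=> z; rewrite /triples Ec Ecs Eas /cyc_triples -map_rot Ek rot1_traject_porbit.
  rewrite -map_comp -[X in zip X _]map_id !zip_map.
  by apply/mapP/mapP => -[d dc ->]; exists d => //; move: dc;
    rewrite mem_enum Eo porbit_traject.
apply/setP=> z; apply/bigcupP/imsetP.
  case=> k _ /bigcupP[i _]; rewrite inE tri => /mapP[c _ ->].
  by exists c.
case=> c _ ->.
have /Cblock_surj[k [i Ei]] : porbit g c \in Cp D by rewrite EC imset_f.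
exists k => //; apply/bigcupP; exists i => //; rewrite inE tri.
by apply: map_f; rewrite mem_enum Ei porbit_id.
Qed.

Lemma Phi_encodes : Phi D = pair_mx g U.
Proof.
apply/matrixP => r c; rewrite !mxE Rset_encodes; congr (if _ then _ else _).
apply/existsP/idP => [[t /and3P[/imsetP[d _ ->] /= /eqP->]] //|H].
by exists (c, (U c, U (g c))); rewrite /= eqxx H andbT imset_f.
Qed.

Lemma well_defined_encodes : (forall c, g c != c) -> well_defined D.
Proof.
move=> ng c; exists (c, (U c, U (g c))); split; last by rewrite /= (inj_eq perm_inj) eq_sym.
rewrite Rset_encodes; apply/setP=> z; rewrite !inE.
apply/andP/eqP => [[/imsetP[d _ ->] /= /eqP->] //|->].
by rewrite /= imset_f.
Qed.

End Datum.

(** * From an oriented pair to a unique datum *)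

Lemma encodes_inj D D' g U :
  in_D D -> in_D D' -> encodes D g U -> encodes D' g U -> D = D'.
Proof.
move=> [_ _ card1 _ _] [_ _ card2 _ _] [C1 A1 B1 H1] [C2 A2 B2 H2].
have Ex : x D = x D'.
  by apply/ffunP => k; rewrite -(card1 k).1 -(card2 k).1 C1 C2.
(* The types of the last three fields depend on [x], so the two [x] are identified before these
   fields are compared. *)
move: D D' Ex card1 card2 C1 A1 B1 H1 C2 A2 B2 H2.
move=> [x1 C1 A1 r1 c1 a1] [x2 C2 A2 r2 c2 a2] /= Ex; subst x2.
move=> card1 card2 EC1 EA1 B1 H1 EC2 EA2 B2 H2; subst C1 A1 C2 A2.
have -> : r1 = r2.
  apply/ffunP=> k; apply/permP=> i; apply/val_inj/eqP.
  have := B1 k i; rewrite -[RHS](B2 k i) /Ablock /=.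
  by move/eqP; rewrite nth_uniq ?blocks_uniq // size_blocks (card1 k).2.
have -> : c1 = c2.
  apply/ffunP=> k; apply: eq_from_tnth => i.
  have [c [E /= T _]] := H1 k i; have [c' [E' /= T' _]] := H2 k i.
  by move: E'; rewrite [setmin _]E => -[Ec]; move: T'; rewrite -Ec -T => -[].
have -> // : a1 = a2.
apply/ffunP=> k; apply: eq_from_tnth => i.
have [c [E _ /= T]] := H1 k i; have [c' [E' _ /= T']] := H2 k i.
by move: E'; rewrite [setmin _]E => -[Ec]; rewrite T T' Ec.
Qed.

(** The permutation [rho k] is forced: it sends the position of a cycle of length [k] to the
    position of its image under [U]. The orderings are trajectories from least elements. *)
Lemma datum_exists g U : oriented g U -> exists D, in_D D /\ encodes D g U.
Proof.
move=> [ng og]; set C := porbits g; pose A := [set U @: (B : {set 'I_n}) | B in C].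
pose x0 := [ffun k : 'I_n.+1 => #|[set B in C | #|B| == k]|].
have cardC (k : 'I_n.+1) : #|[set B in C | #|B| == k]| = x0 k by rewrite ffunE.
have U_inj : injective (fun B : {set 'I_n} => U @: B) := imset_inj (@perm_inj _ U).
have cardA (k : 'I_n.+1) : #|[set B in A | #|B| == k]| = x0 k.
  rewrite -cardC -[RHS](card_imset _ U_inj); apply: eq_card => B; rewrite !inE.
  apply/andP/imsetP => [[/imsetP[B' B'C ->]]|[B']].
    by rewrite card_imset; [exists B'; rewrite ?inE ?B'C|exact: perm_inj].
  rewrite inE => /andP[B'C B'k] ->; rewrite imset_f //.
  by rewrite card_imset //; exact: perm_inj.
have rho_ex (k : 'I_n.+1) : exists r : 'S_(x0 k), forall i,
    nth set0 (blocks A k) (r i) = U @: nth set0 (blocks C k) i.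
  (* The default [i] of [insubd] is not reached: the image is a listed block, so its index is below
     [x0 k]. *)
  pose r0 (i : 'I_(x0 k)) : 'I_(x0 k) :=
    insubd i (index (U @: nth set0 (blocks C k) i) (blocks A k)).
  have r0E i : nth set0 (blocks A k) (r0 i) = U @: nth set0 (blocks C k) i.
    have [BC Bk] := nth_blocksP cardC i.
    have BA : U @: nth set0 (blocks C k) i \in blocks A k.
      by rewrite mem_blocks imset_f //= card_imset ?Bk //; exact: perm_inj.
    rewrite val_insubd; case: ifPn => [_|]; first exact: nth_index.
    by rewrite -[X in _ < X]cardA -size_blocks index_mem BA.
  have r_inj : injective r0.
    move=> i j E; have := r0E i; rewrite E r0E => /U_inj/eqP.
    rewrite nth_uniq ?blocks_uniq ?size_blocks ?cardC // => /eqP/val_inj.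
    by move->.
  by exists (perm r_inj) => i; rewrite permE r0E.
have [r rE] := fin_all_exists rho_ex.
(* The trajectory starts at [g c] and is one shorter than the cycle, since [c_1] is not part of the
   stored ordering. *)
pose cs (B : {set 'I_n}) :=
  if setmin B is Some c then traject g (g c) #|B|.-1 else [::].
pose rs (B : {set 'I_n}) :=
  if setmin B is Some c then map U (traject g c #|B|) else [::].
pose D := @Data n x0 C A (finfun r)
  (finfun (fun k : 'I_n.+1 => [tuple cs (nth set0 (blocks C k) i) | i < x0 k]))
  (finfun (fun k : 'I_n.+1 => [tuple rs (nth set0 (blocks C k) i) | i < x0 k])).
have key (k : 'I_n.+1) (i : 'I_(x D k)) : exists c,
    [/\ setmin (Cblock i) = Some c, Cblock i = porbit g c & #|porbit g c| = k].
  have [/imsetP[d _ Ed] Bk] := nth_blocksP cardC i.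
  have [|c Ec] := @setmin_exists _ (Cblock i).
    by apply/set0Pn; exists d; rewrite /Cblock /= Ed porbit_id.
  have [cB _] := setmin_min Ec; exists c; rewrite Ec.
  have Ep : Cblock i = porbit g c.
    by rewrite /Cblock /= Ed; apply/esym/porbit_eq; rewrite -Ed.
  by rewrite -Ep.
have cordE (k : 'I_n.+1) (i : 'I_(x D k)) : tnth (cord D k) i = cs (Cblock i).
  by rewrite [cord D k]ffunE tnth_mktuple.
have aordE (k : 'I_n.+1) (i : 'I_(x D k)) : tnth (aord D k) i = rs (Cblock i).
  by rewrite [aord D k]ffunE tnth_mktuple.
have AE (k : 'I_n.+1) (i : 'I_(x D k)) : Ablock i = U @: Cblock i.
  by rewrite /Ablock [rho D k]ffunE rE.
exists D; split; split=> //.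
- have sizeC B : B \in C -> 1 < #|B|.
    by case/imsetP=> c _ ->; rewrite card_porbit_gt1.
  split=> [k k2|].
    rewrite -cardC; apply: eq_card0 => B; rewrite !inE.
    by apply/negP => /andP[/sizeC + /eqP Bk]; rewrite Bk ltnNge -ltnS k2.
  rewrite -[RHS]card_ord -cardsT (card_partition (porbits_partition g)).
  (* The cardinalities of the cycles sum to [n]; group them by size, where [inord] loses nothing
     because sizes are at most [n]. *)
  rewrite (partition_big (fun B : {set 'I_n} => inord #|B| : 'I_n.+1) predT) //=.
  apply: eq_bigr => k _; rewrite -cardC mulnC -sum_nat_const.
  have inordE (B : {set 'I_n}) : (inord #|B| == k :> 'I_n.+1) = (#|B| == k).
    by rewrite -val_eqE /= inordK // ltnS -[X in _ <= X]card_ord max_card.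
  rewrite (eq_bigl (fun B => (B \in C) && (inord #|B| == k))).
    by apply: eq_bigr => B /andP[_]; rewrite inordE => /eqP.
  by move=> B; rewrite !inE inordE.
- split; first exact: porbits_partition.
  have <- : U @: [set: 'I_n] = setT.
    by apply/setP=> a; rewrite inE; apply/imsetP; exists (U^-1 a)%g; rewrite ?permKV.
  by rewrite imset_partition; [exact: porbits_partition|exact: perm_inj].
- by move=> k; split; [apply: cardC|apply: cardA].
- move=> k i; have [c [Ec Ep Ek]] := key k i.
  rewrite cordE /cs Ec Ep Ek -Ek.
  have := uniq_traject_porbit g c; have := porbit_traject g c.
  have := card_porbit_neq0 g c; case: #|_| => //= m _ Et /andP[nc u].
  apply: uniq_perm; rewrite ?enum_uniq // => d; rewrite mem_enum !inE Et inE.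
  by case: eqP => //= ->; rewrite (negPf nc).
- move=> k i; have [c [Ec Ep Ek]] := key k i.
  rewrite aordE /rs Ec AE Ep; split; last first.
    have := ng c; rewrite -card_porbit_gt1; case: #|_| => [|[]] //= _ _.
    by apply: og => d dc; apply: (setmin_min Ec).2; rewrite Ep.
  apply: uniq_perm; rewrite ?enum_uniq ?map_inj_uniq ?uniq_traject_porbit //.
    exact: perm_inj.
  move=> a; rewrite mem_enum.
  by apply/mapP/imsetP => -[d dc ->]; exists d => //; move: dc; rewrite porbit_traject.
- move=> k i; have [c [Ec Ep Ek]] := key k i; exists c; split=> //.
    rewrite cordE /cs Ec Ep Ek -Ek; have := card_porbit_neq0 g c.
    by case: #|_|.
  by rewrite aordE /rs Ec Ep Ek.
Qed.

End Encoding.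

(** * Assembly of the bijection *)

Theorem theorem1 (n : nat) (hn : 2 <= n) :
  (forall D : data n, in_D D -> well_defined D /\ is_Lambda2 (Phi D)) /\
  (forall D D' : data n, in_D D -> in_D D' -> D <> D' -> Phi D <> Phi D') /\
  (forall M : 'M[nat]_n, is_Lambda2 M -> exists D : data n, in_D D /\ Phi D = M).
Proof.
split; [|split].
- move=> D inD; have [g [U [o enc]]] := encodes_exists inD.
  split; first exact: (well_defined_encodes inD enc o.1).
  by have -> := Phi_encodes inD enc; exact: (pair_mx_Lambda2 U o.1).
- move=> D D' inD inD' nDD' E; apply: nDD'.
  have [g [U [o enc]]] := encodes_exists inD.
  have [g' [U' [o' enc']]] := encodes_exists inD'.
  have E1 := Phi_encodes inD enc; have E2 := Phi_encodes inD' enc'.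
  have [Eg EU] := pair_mx_inj o o' (etrans (etrans (esym E1) E) E2); subst g' U'.
  exact: (encodes_inj inD inD' enc enc').
- move=> M LM; have [g [U [o <-]]] := Lambda2_orientation LM.
  have [D [inD enc]] := datum_exists o.
  by exists D; split=> //; exact: (Phi_encodes inD enc).
Qed.
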